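(* Let $(M,J,g)$ be an almost Hermitian non Kähler manifold of type $\mathcal{G}_1$. Then $$\pi(\nabla^{+})=\nabla^{+},\quad \pi(\nabla^{-})=\nabla^{\mathrm{c}},$$ where $\nabla^{\mathrm{c}}$ is the Chern connection of $(M,J,g)$, $\nabla^{\pm}=\nabla^{\mathrm{g}}\pm\frac12\mathrm{T}^{\mathrm{sk}}$ with $\mathrm{T}^{\mathrm{sk}}$ the torsion of the unique Hermitian connection with totally skew-symmetric torsion, and $\pi$ is the projection of linear connections onto the connections adapted to $J$ given by $$(\pi(\nabla))_X Y=\frac12\nabla_X Y-\frac12 J(\nabla_X(JY)),\quad \forall X,Y\in\mathfrak{X}(M).$$
   Context: All manifolds and operators are of class $C^{\infty}$; $\mathfrak{X}(M)$ is the module of vector fields on $M$. An almost Hermitian manifold $(M,J,g)$ is a manifold with a Riemannian metric $g$ and a $(1,1)$ tensor field $J$ such that $J^{2}=-Id$ and $g(JX,JY)=g(X,Y)$ for all $X,Y\in\mathfrak{X}(M)$. $\nabla^{\mathrm{g}}$ denotes the Levi Civita connection of $g$. The manifold is Kähler if $\nabla^{\mathrm{g}}J=0$; it is non Kähler otherwise. A Hermitian connection (connection adapted to $(J,g)$) is a linear connection $\nabla$ with $\nabla J=0$ and $\nabla g=0$. Type $\mathcal{G}_1$ refers to the Gray–Hervella class $\mathcal{G}_1=\mathcal{W}_1\oplus\mathcal{W}_3\oplus\mathcal{W}_4$, i.e. the Nijenhuis tensor $N_J$ of $J$ is such that $(X,Y,Z)\mapsto g(N_J(X,Y),Z)$ is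 totally skew-symmetric. Known fact used to define the objects: on an almost Hermitian manifold of type $\mathcal{G}_1$ there exists a unique Hermitian connection $\nabla^{\mathrm{sk}}$ whose torsion tensor $\mathrm{T}^{\mathrm{sk}}$ is totally skew-symmetric (i.e. $(X,Y,Z)\mapsto g(\mathrm{T}^{\mathrm{sk}}(X,Y),Z)$ is totally skew-symmetric). One defines $$\nabla^{+}_X Y=\nabla^{\mathrm{g}}_X Y+\frac12\mathrm{T}^{\mathrm{sk}}(X,Y),\quad \nabla^{-}_X Y=\nabla^{\mathrm{g}}_X Y-\frac12\mathrm{T}^{\mathrm{sk}}(X,Y),\quad\forall X,Y\in\mathfrak{X}(M).$$ The Chern connection $\nabla^{\mathrm{c}}$ of an almost Hermitian manifold $(M,J,g)$ is the unique linear connection with $\nabla^{\mathrm{c}}J=0$, $\nabla^{\mathrm{c}}g=0$ whose torsion tensor $\mathrm{T}^{\mathrm{c}}$ satisfies $\mathrm{T}^{\mathrm{c}}(JX,JY)=-\mathrm{T}^{\mathrm{c}}(X,Y)$ for all $X,Y\in\mathfrak{X}(M)$ (its existence and uniqueness are known). *)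

(* Defs.v *)
From HB Require Import structures.
From mathcomp Require Import all_boot all_order all_algebra.
From mathcomp Require Import all_classical all_reals all_analysis.
From mathcomp Require Import ring.

Set Implicit Arguments.
Unset Strict Implicit.
Unset Printing Implicit Defensive.

Import Order.TTheory GRing.Theory Num.Theory numFieldNormedType.Exports.

Local Open Scope classical_set_scope.
Local Open Scope ring_scope.

Section Euclidean.
Context {R : realType} {n : nat}.
Implicit Types (U : set 'rV[R]_n) (f g : 'rV[R]_n -> R) (k : nat).

Fixpoint Ck U k f : Prop :=
  {in U, continuous f} /\
  if k is k'.+1 then
    forall i : 'I_n, {in U, forall x, derivable f x 'e_i} /\
                     Ck U k' (fun x => 'D_'e_i f x)
  else True.

Definition smooth_on U f := forall k, Ck U k f.

Lemma Ck_ext U k f g : open U -> {in U, f =1 g} -> Ck U k f -> Ck U k g.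
Proof.
move=> oU; elim: k f g => [|k IH] f g fg.
all: have nfg x : x \in U -> \near x, f x = g x.
1,3: by move=> /set_mem Ux; apply: filterS (open_nbhs_nbhs (conj oU Ux)) => y Uy;
     apply/fg/mem_set.
all: have cfg : {in U, continuous f} -> {in U, continuous g}.
1,3: by move=> cf x Ux; rewrite /continuous_at -(fg x Ux);
     apply: cvg_trans (cf x Ux); exact: near_eq_cvg (nfg x Ux).
  by case=> cf _; split => //; exact: cfg.
case=> cf df; split; first exact: cfg.
move=> i; have [d1 d2] := df i; split.
  move=> x Ux; exact: (near_eq_derivable (nfg x Ux) (d1 x Ux)).
apply: (IH _ _ _ d2) => x Ux; apply: near_eq_derive; exact: nfg.
Qed.

Lemma CkS U k f : Ck U k.+1 f -> Ck U k f.
Proof.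
elim: k f => [|k IH] f [cf df]; first by [].
by split=> [|i]; [exact: cf|have [d1 d2] := df i; split; [exact: d1|exact: IH]].
Qed.

Lemma CkW U k f : Ck U k f -> {in U, continuous f}.
Proof. by case: k => [|k] []. Qed.

Lemma Ck_cst U k (c : R) : Ck U k (fun=> c).
Proof.
elim: k c => [|k IH] c.
  by split=> [x _|]; [exact: cst_continuous|].
split=> [x _|i]; first exact: cst_continuous.
split=> [x _|]; first exact: derivable_cst.
have -> : (fun x => 'D_('e_i) (fun=> c) x) = (fun=> 0) :> ('rV[R]_n -> R).
  by apply/funext => x; rewrite derive_cst.
exact: IH.
Qed.

Lemma Ck_add U k f g : open U ->
  Ck U k f -> Ck U k g -> Ck U k (fun x => f x + g x).
Proof.
move=> oU; elim: k f g => [|k IH] f g [cf df] [cg dg].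
all: split.
1,3: by move=> x Ux; exact: (cvgD (cf x Ux) (cg x Ux)).
  by [].
move=> i; have [f1 f2] := df i; have [g1 g2] := dg i; split.
  by move=> x Ux; apply: derivableD; [exact: f1|exact: g1].
apply: (Ck_ext oU _ (IH _ _ f2 g2)) => x Ux.
by rewrite -deriveD//; [exact: f1|exact: g1].
Qed.

Lemma Ck_mul U k f g : open U ->
  Ck U k f -> Ck U k g -> Ck U k (fun x => f x * g x).
Proof.
move=> oU; elim: k f g => [|k IH] f g Cf Cg.
all: have [cf df] := Cf; have [cg dg] := Cg; split.
1,3: by move=> x Ux; exact: (cvgM (cf x Ux) (cg x Ux)).
  by [].
move=> i; have [f1 f2] := df i; have [g1 g2] := dg i; split.
  by move=> x Ux; apply: derivableM; [exact: f1|exact: g1].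
apply: (Ck_ext oU _ (Ck_add oU (IH _ _ (CkS Cf) g2) (IH _ _ (CkS Cg) f2))).
by move=> x Ux; rewrite -deriveM//; [exact: f1|exact: g1].
Qed.

End Euclidean.

(* [chart_map] and [chart_inv] are total functions, but only their values on
   [chart_dom] and [chart_cod] respectively are meaningful. *)
Record chart (R : realType) (n : nat) (T : topologicalType) := Chart {
  chart_dom : set T;
  chart_cod : set 'rV[R]_n;
  chart_map : T -> 'rV[R]_n;
  chart_inv : 'rV[R]_n -> T;
  chart_dom_open : open chart_dom;
  chart_cod_open : open chart_cod;
  chart_map_cod : {homo chart_map : p / chart_dom p >-> chart_cod p};
  chart_inv_dom : {homo chart_inv : x / chart_cod x >-> chart_dom x};
  chart_mapK : {in chart_dom, cancel chart_map chart_inv};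
  chart_invK : {in chart_cod, cancel chart_inv chart_map};
  chart_map_cont : {in chart_dom, continuous chart_map};
  chart_inv_cont : {in chart_cod, continuous chart_inv} }.

Arguments chart_dom_open {R n T} c.
Arguments chart_cod_open {R n T} c.

Definition smooth_transition (R : realType) n (T : topologicalType)
    (c d : chart R n T) :=
  forall i : 'I_n, smooth_on (chart_cod c `&` chart_inv c @^-1` chart_dom d)
    (fun x => chart_map d (chart_inv c x) 0 i).

Record manifold (R : realType) (n : nat) := Manifold {
  mcarrier :> topologicalType;
  atlas : set (chart R n mcarrier);
  manifold_hausdorff : hausdorff_space mcarrier;
  manifold_second_countable : @second_countable mcarrier;
  atlas_cover : \bigcup_(c in atlas) chart_dom c = [set: mcarrier];
  atlas_compat : forall c d, atlas c -> atlas d -> smooth_transition c d }.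

Section SmoothFunctions.
Context {R : realType} {n : nat} (M : manifold R n).

Definition is_smooth (f : M -> R^o) :=
  forall c, atlas c -> smooth_on (chart_cod c) (f \o chart_inv c).

Definition smooth_pred : {pred M -> R^o} := fun f => `[< is_smooth f >].

Lemma smooth_subring : subring_closed smooth_pred.
Proof.
split=> [|f g /asboolP sf /asboolP sg|f g /asboolP sf /asboolP sg];
  apply/asboolP => c ac k; have oc := chart_cod_open c.
- exact: Ck_cst.
- apply: (Ck_ext oc _
    (Ck_add oc (sf c ac k) (Ck_mul oc (Ck_cst _ k (-1)) (sg c ac k)))).
  by move=> x _ /=; rewrite mulN1r.
- by apply: (Ck_ext oc _ (Ck_mul oc (sf c ac k) (sg c ac k))) => x _.
Qed.

Lemma smooth_subsemimod : GRing.subsemimod_closed smooth_pred.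
Proof.
apply: GRing.submod_closed_semi; split=> [|a f h /asboolP sf /asboolP sh];
  apply/asboolP => c ac k; first exact: Ck_cst.
have oc := chart_cod_open c.
apply: (Ck_ext oc _
  (Ck_add oc (Ck_mul oc (Ck_cst _ k a) (sf c ac k)) (sh c ac k))).
by move=> x _.
Qed.

Definition smooth_fun : Type := {f : M -> R^o | smooth_pred f}.

HB.instance Definition _ := [isSub of smooth_fun for @sval _ _].
HB.instance Definition _ := [Choice of smooth_fun by <:].
HB.instance Definition _ :=
  GRing.SubChoice_isSubComPzRing.Build (M -> R^o) smooth_pred smooth_fun
    smooth_subring.
HB.instance Definition _ :=
  GRing.SubZmodule_isSubLmodule.Build R (M -> R^o) smooth_pred smooth_fun
    smooth_subsemimod.

Definition smooth_eval (f : smooth_fun) : M -> R := val f.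

Definition smooth_cst (a : R) : smooth_fun := a *: (1 : smooth_fun).

End SmoothFunctions.

Coercion smooth_eval : smooth_fun >-> Funclass.
Notation "C^oo( M )" := (smooth_fun M) (at level 0, format "C^oo( M )").

(* A vector field is a derivation of the R-algebra of smooth functions. *)
Section VectorFields.
Context {R : realType} {n : nat} (M : manifold R n).
Implicit Types D E : C^oo(M) -> C^oo(M)^o.

Definition is_derivation D :=
  linear (D : C^oo(M) -> C^oo(M)) /\
  forall f h, D (f * h) = D f * h + f * D h.

Definition derivation_pred : {pred C^oo(M) -> C^oo(M)^o} :=
  fun D => `[< is_derivation D >].

Lemma smooth_scalerAl (a : R) (f h : C^oo(M)) : a *: (f * h) = a *: f * h.
Proof.
apply: val_inj; change (a *: (val f * val h) = (a *: val f) * val h).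
by apply/funext => p; rewrite !scalrfctE !mulrfctE -mulrA.
Qed.

Lemma smooth_scalerAr (a : R) (f h : C^oo(M)) : a *: (f * h) = f * (a *: h).
Proof. by rewrite mulrC smooth_scalerAl mulrC. Qed.

Lemma derivation_subsemimod : GRing.subsemimod_closed derivation_pred.
Proof.
split; first split.
- apply/asboolP; split=> [a f h|f h]; first by rewrite /= scaler0 addr0.
  by rewrite /= mul0r mulr0 addr0.
- move=> D E /asboolP[lD dD] /asboolP[lE dE]; apply/asboolP; split.
    move=> a f h; rewrite [LHS]/= !addrfctE lD lE scalerDr.
    by rewrite addrACA.
  by move=> f h; rewrite !addrfctE dD dE mulrDl mulrDr addrACA.
- move=> u D /asboolP[lD dD]; apply/asboolP; split.
    move=> a f h; rewrite [LHS]/= !scalrfctE lD.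
    rewrite /GRing.scale/=.
    by rewrite mulrDr -smooth_scalerAr.
  move=> f h; rewrite !scalrfctE dD scalerDr; congr (_ + _).
    by rewrite /GRing.scale/= mulrA.
  by rewrite /GRing.scale/= mulrCA.
Qed.

Definition vector_field : Type :=
  {D : C^oo(M) -> C^oo(M)^o | derivation_pred D}.

HB.instance Definition _ := [isSub of vector_field for @sval _ _].
HB.instance Definition _ := [Choice of vector_field by <:].
HB.instance Definition _ :=
  GRing.SubChoice_isSubLmodule.Build C^oo(M) (C^oo(M) -> C^oo(M)^o)
    derivation_pred vector_field derivation_subsemimod.

Definition vf_apply (X : vector_field) : C^oo(M) -> C^oo(M) := val X.
Coercion vf_apply : vector_field >-> Funclass.

Lemma vfP (X : vector_field) : is_derivation X.
Proof. exact/asboolP/(valP X). Qed.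

Lemma bracket_subproof (X Y : vector_field) :
  derivation_pred (fun f => X (Y f) - Y (X f)).
Proof.
have [lX dX] := vfP X; have [lY dY] := vfP Y.
have XD f h : X (f + h) = X f + X h by have := lX 1 f h; rewrite !scale1r.
have YD f h : Y (f + h) = Y f + Y h by have := lY 1 f h; rewrite !scale1r.
apply/asboolP; split.
  move=> a f h; rewrite lX lY lX lY scalerBr opprD addrACA.
  by [].
move=> f h; rewrite dX dY XD YD !dX !dY mulrBl mulrBr.
ring.
Qed.

Definition bracket (X Y : vector_field) : vector_field :=
  Sub (fun f => X (Y f) - Y (X f)) (bracket_subproof X Y).

End VectorFields.

Notation "''X(' M )" := (vector_field M) (at level 0, format "''X(' M )").
Notation "[[ X , Y ]]" := (bracket X Y).

(* Tensor fields are given by their C^oo(M)-multilinear action on vector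
   fields. In particular [linear] below is C^oo(M)-linearity, since 'X(M) is
   an [lmodType C^oo(M)]. *)
Section Geometry.
Context {R : realType} {n : nat} {M : manifold R n}.
Implicit Types (J : {linear 'X(M) -> 'X(M)}) (g : 'X(M) -> 'X(M) -> C^oo(M)).
Implicit Types (nabla T : 'X(M) -> 'X(M) -> 'X(M)) (X Y Z : 'X(M)).

(* [forall f, X f p = 0] says that the tangent vector X_p is zero. *)
Definition riemannian_metric g :=
  [/\ forall (f : C^oo(M)) X Y Z, g (f *: X + Y) Z = f * g X Z + g Y Z,
      forall X Y, g X Y = g Y X,
      forall X (p : M), 0 <= g X X p
    & forall X (p : M), g X X p = 0 -> forall f : C^oo(M), X f p = 0].

Definition almost_hermitian J g :=
  [/\ riemannian_metric g, forall X, J (J X) = - X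
    & forall X Y, g (J X) (J Y) = g X Y].

Definition linear_connection nabla :=
  [/\ forall Y, linear (fun X => nabla X Y),
      forall X Y Z, nabla X (Y + Z) = nabla X Y + nabla X Z
    & forall X (f : C^oo(M)) Y, nabla X (f *: Y) = X f *: Y + f *: nabla X Y].

Definition torsion nabla X Y := nabla X Y - nabla Y X - [[X, Y]].

Definition cov_J nabla J X Y := nabla X (J Y) - J (nabla X Y).

Definition cov_g nabla g X Y Z :=
  X (g Y Z) - g (nabla X Y) Z - g Y (nabla X Z).

Definition parallel_J nabla J := forall X Y, cov_J nabla J X Y = 0.
Definition parallel_g nabla g := forall X Y Z, cov_g nabla g X Y Z = 0.

Definition levi_civita g nabla :=
  [/\ linear_connection nabla, parallel_g nabla g
    & forall X Y, torsion nabla X Y = 0].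

Definition hermitian_connection J g nabla :=
  [/\ linear_connection nabla, parallel_J nabla J & parallel_g nabla g].

Definition totally_skew g T :=
  (forall X Y Z, g (T X Y) Z = - g (T Y X) Z) /\
  (forall X Y Z, g (T X Y) Z = - g (T X Z) Y).

Definition nijenhuis J X Y :=
  [[J X, J Y]] - J [[J X, Y]] - J [[X, J Y]] - [[X, Y]].

Definition type_G1 J g := totally_skew g (nijenhuis J).

Definition skew_torsion_connection J g nabla :=
  hermitian_connection J g nabla /\ totally_skew g (torsion nabla).

Definition chern_connection J g nabla :=
  hermitian_connection J g nabla /\
  forall X Y, torsion nabla (J X) (J Y) = - torsion nabla X Y.

Definition smooth_half : C^oo(M) := smooth_cst M 2^-1.

Definition nabla_plus nabla_g nabla_sk X Y : 'X(M) :=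
  nabla_g X Y + smooth_half *: torsion nabla_sk X Y.

Definition nabla_minus nabla_g nabla_sk X Y : 'X(M) :=
  nabla_g X Y - smooth_half *: torsion nabla_sk X Y.

Definition pi_J J nabla X Y :=
  smooth_half *: nabla X Y - smooth_half *: J (nabla X (J Y)).

End Geometry.

(* Main.v *)
Require Import Defs.
From mathcomp Require Import all_boot all_order all_algebra.
From mathcomp Require Import all_classical all_reals all_analysis.
From mathcomp Require Import lra.

(* The difference A = nabla_sk - nabla_g is skew in its last two slots because
   both connections are metric, and its antisymmetrization is T_sk, which is
   totally skew; hence A is itself antisymmetric, so T_sk = 2 A and
   nabla_plus = nabla_sk, which pi fixes because nabla_sk is J-parallel. It
   follows that nabla_minus = nabla_sk - 2 A, so
   pi (nabla_minus) X Y = nabla_sk X Y + J (A X (J Y)) - A X Y.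
   This connection is Hermitian with torsion J (A X (J Y) + A (J X) Y), which
   changes sign under (X, Y) -> (J X, J Y): it is the Chern connection. *)

Set Implicit Arguments.
Unset Strict Implicit.
Unset Printing Implicit Defensive.

Import GRing.Theory.

Local Open Scope ring_scope.

(** * Differences of linear connections as tensors *)

Section Connections.
Context {R : realType} {n : nat} {M : manifold R n}.
Implicit Types J : {linear 'X(M) -> 'X(M)}.
Implicit Types (A D : 'X(M) -> 'X(M) -> 'X(M)) (X Y Z : 'X(M)).

Lemma smooth_half_double : smooth_half + smooth_half = 1 :> C^oo(M).
Proof.
rewrite /smooth_half /smooth_cst -scalerDl.
have -> : 2^-1 + 2^-1 = 1 :> R by lra.
by rewrite scale1r.
Qed.

(** The scalars of ['X(M)] are smooth functions, so halving a field means scaling it by the constant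
    function [smooth_half]. *)
Lemma smooth_halfK X : smooth_half *: (X + X) = X.
Proof. by rewrite scalerDr -scalerDl smooth_half_double scale1r. Qed.

Lemma smooth_eq_opp (f : C^oo(M)) : f = - f -> f = 0.
Proof.
move=> ff; have ff0 : f + f = 0 by rewrite {1}ff addNr.
by rewrite -[f]mul1r -smooth_half_double mulrDl -mulrDr ff0 mulr0.
Qed.

Lemma vf_eq_opp X : X = - X -> X = 0.
Proof.
by move=> XX; rewrite -[X]smooth_halfK {1}XX addNr scaler0.
Qed.

Definition bilinear_map A :=
  (forall (f : C^oo(M)) X Y Z, A (f *: X + Y) Z = f *: A X Z + A Y Z) /\
  (forall (f : C^oo(M)) X Y Z, A X (f *: Y + Z) = f *: A X Y + A X Z).

Lemma bilinear0r A X : bilinear_map A -> A X 0 = 0.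
Proof.
move=> [_ lA]; apply: (addrI (A X 0)).
by have := lA 1 X 0 0; rewrite !scale1r !addr0.
Qed.

Lemma bilinearNl A X Y : bilinear_map A -> A (- X) Y = - A X Y.
Proof.
move=> [lA _]; have A0 : A 0 Y = 0.
  by apply: (addrI (A 0 Y)); have := lA 1 0 0 Y; rewrite !scale1r !addr0.
by have := lA (-1) X 0 Y; rewrite A0 !addr0 !scaleN1r.
Qed.

Lemma bilinearNr A X Y : bilinear_map A -> A X (- Y) = - A X Y.
Proof.
move=> bA; have := bA.2 (-1) X Y 0.
by rewrite (bilinear0r _ bA) !addr0 !scaleN1r.
Qed.

(** The Leibniz term [X f *: Y] is the same for both connections and cancels. *)
Lemma connection_sub D D' : linear_connection D -> linear_connection D' ->
  bilinear_map (fun X Y => D X Y - D' X Y).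
Proof.
move=> [l1 a1 d1] [l2 a2 d2]; split=> f X Y Z.
  have := l1 Z f X Y; have := l2 Z f X Y => /= -> ->.
  by rewrite scalerBr opprD addrACA.
rewrite a1 a2 d1 d2 opprD addrACA opprD.
by rewrite (addrACA (X f *: Y)) subrr add0r scalerBr.
Qed.

Lemma connection_add D A : linear_connection D -> bilinear_map A ->
  linear_connection (fun X Y => D X Y + A X Y).
Proof.
move=> [l1 a1 d1] bA; split=> [Y f X Z|X Y Z|X f Y] /=.
- have := l1 Y f X Z => /= ->.
  by rewrite bA.1 scalerDr addrACA.
- have := bA.2 1 X Y Z; rewrite !scale1r => ->.
  by rewrite a1 addrACA.
- have := bA.2 f X Y 0; rewrite (bilinear0r _ bA) !addr0 => ->.
  by rewrite d1 scalerDr addrA.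
Qed.

Lemma torsion_add D A X Y :
  torsion (fun X Y => D X Y + A X Y) X Y = torsion D X Y + (A X Y - A Y X).
Proof. by rewrite /torsion/= [RHS]addrAC opprD addrACA. Qed.

Lemma torsion_sub D D' X Y :
  D X Y - D' X Y - (D Y X - D' Y X) = torsion D X Y - torsion D' X Y.
Proof.
rewrite opprD addrACA -opprD /torsion [in RHS]opprD opprK.
by rewrite [RHS]addrACA addNr addr0.
Qed.

Lemma parallel_J_sub J D D' : parallel_J D J -> parallel_J D' J ->
  forall X Y, D X (J Y) - D' X (J Y) = J (D X Y - D' X Y).
Proof.
move=> pD pD' X Y; rewrite (linearB J).
have /eqP := pD X Y; have /eqP := pD' X Y.
by rewrite !subr_eq0 => /eqP-> /eqP->.
Qed.

Lemma parallel_J_add J D A : parallel_J D J ->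
  (forall X Y, A X (J Y) = J (A X Y)) ->
  parallel_J (fun X Y => D X Y + A X Y) J.
Proof.
move=> pD JA X Y; rewrite /cov_J (linearD J) JA opprD addrACA subrr addr0.
exact: pD.
Qed.

End Connections.

(** * Metric connections and nondegeneracy of the metric *)

Section Metric.
Context {R : realType} {n : nat} {M : manifold R n}.
Context {g : 'X(M) -> 'X(M) -> C^oo(M)} (rg : riemannian_metric g).
Implicit Types (A D : 'X(M) -> 'X(M) -> 'X(M)) (X Y Z : 'X(M)).

Lemma metricC X Y : g X Y = g Y X.
Proof. by case: rg. Qed.

Lemma metricDl X Y Z : g (X + Y) Z = g X Z + g Y Z.
Proof. by case: rg => l _ _ _; have := l 1 X Y Z; rewrite scale1r mul1r. Qed.

Lemma metric0l Z : g 0 Z = 0.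
Proof. by apply: (addrI (g 0 Z)); rewrite -metricDl !addr0. Qed.

Lemma metricNl X Z : g (- X) Z = - g X Z.
Proof. by apply/eqP; rewrite -addr_eq0 -metricDl addNr metric0l. Qed.

Lemma metricDr X Y Z : g X (Y + Z) = g X Y + g X Z.
Proof. by rewrite metricC metricDl !(metricC X). Qed.

(** Definiteness at each point, applied with [Z = X], kills every value [X f p], and these values
    determine [X]. *)
Lemma metric_eq0 X : (forall Z, g X Z = 0) -> X = 0.
Proof.
move=> gX; apply: val_inj; apply/funext => f; apply: val_inj; apply/funext => p.
by case: rg => _ _ _; apply; rewrite gX.
Qed.

(** Both conditions expand the same function [X (g Y Z)], which drops out on subtraction. *)
Lemma parallel_g_sub D D' : parallel_g D g -> parallel_g D' g ->
  forall X Y Z, g (D X Y - D' X Y) Z = - g (D X Z - D' X Z) Y.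
Proof.
move=> pD pD' X Y Z; rewrite !metricDl !metricNl ![g _ Y]metricC.
have /eqP := pD X Y Z; have /eqP := pD' X Y Z.
rewrite /cov_g -!addrA -!opprD !subr_eq0 => /eqP -> /eqP e.
by apply/eqP; rewrite opprB -subr_eq0 opprB addrACA -opprD -e subrr.
Qed.

Lemma parallel_g_add D A : parallel_g D g ->
  (forall X Y Z, g (A X Y) Z = - g (A X Z) Y) ->
  parallel_g (fun X Y => D X Y + A X Y) g.
Proof.
move=> pD sA X Y Z; rewrite /cov_g metricDl metricDr (metricC Y (A _ _)) sA.
by rewrite -[RHS](pD X Y Z) /cov_g -!addrA -!opprD addrACA addNr addr0.
Qed.

(* With [a(x,y,z) = g (A x y) z] skew in [y, z], total skewness of
   [a(x,y,z) - a(y,x,z)] makes [a] invariant under cyclic permutations. *)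
Lemma skew_of_totally_skew A :
  (forall X Y Z, g (A X Y) Z = - g (A X Z) Y) ->
  totally_skew g (fun X Y => A X Y - A Y X) ->
  forall X Y, A Y X = - A X Y.
Proof.
move=> sA [_ sT].
have cyc X Y Z : g (A Z X) Y = g (A Y Z) X.
  have := sT X Y Z; rewrite !metricDl !metricNl opprB (sA X Z Y) opprK.
  by rewrite addrC => /addIr <-; rewrite (sA Y X Z) opprK.
move=> X Y; apply/eqP; rewrite -addr_eq0; apply/eqP/metric_eq0 => Z.
by rewrite metricDl (cyc X Z Y) (cyc Y X Z) (sA X Z Y) addNr.
Qed.

(** * Almost Hermitian structure and uniqueness of the Chern connection *)

Context {J : {linear 'X(M) -> 'X(M)}} (aJ : almost_hermitian J g).

Lemma hermitian_adj X Y : g (J X) Y = - g X (J Y).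
Proof. by case: aJ => _ J2 gJ; rewrite -gJ J2 metricNl. Qed.

Lemma J_eq0 X : J X = 0 -> X = 0.
Proof.
case: aJ => _ J2 _ /(congr1 J); rewrite J2 linear0 => /eqP.
by rewrite oppr_eq0 => /eqP.
Qed.

(* [C X Y = A (J X) Y - J (A X Y)] is symmetric, J-linear in [Y] and
   J-antilinear in [X], hence zero; then [A] is J-linear in both arguments,
   which is incompatible with skewness unless it vanishes. *)
Lemma hermitian_difference_eq0 A : bilinear_map A ->
  (forall X Y, A X (J Y) = J (A X Y)) ->
  (forall X Y Z, g (A X Y) Z = - g (A X Z) Y) ->
  (forall X Y, A (J X) (J Y) - A (J Y) (J X) = - (A X Y - A Y X)) ->
  forall X Y, A X Y = 0.
Proof.
case: aJ => _ J2 gJ bA AJ sA tA.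
have AJl X Y : A (J X) Y = J (A X Y).
  pose C X Y : 'X(M) := A (J X) Y - J (A X Y).
  have CJr X' Y' : C X' (J Y') = J (C X' Y') by rewrite /C !AJ (linearB J).
  have CJl X' Y' : C (J X') Y' = - J (C X' Y').
    by rewrite /C J2 bilinearNl// (linearB J) J2 opprB.
  (* Symmetry comes from [tA]: [AJ] pulls [J] out of the second slots, and applying [J] once more
     removes it. *)
  have Csym X' Y' : C X' Y' = C Y' X'.
    have e : A (J X') Y' - A (J Y') X' = J (A X' Y') - J (A Y' X').
      apply: oppr_inj; have := congr1 J (tA X' Y').
      by rewrite !AJ -(linearB J) J2 (linearN J) (linearB J).
    apply/eqP; rewrite /C subr_eq -addrA [- _ + _]addrC addrC -subr_eq.
    exact/eqP.
  have /J_eq0 /eqP : J (C X Y) = 0.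
    by apply: vf_eq_opp; rewrite -CJl [RHS]Csym CJr (Csym X).
  by rewrite subr_eq0 => /eqP.
(* Skewness, moving [J] across [g], and skewness again contribute three signs and return the same
   expression negated. *)
have Az X Y : A (J X) Y = 0.
  apply: metric_eq0 => Z; apply: smooth_eq_opp.
  by rewrite [LHS]sA AJl hermitian_adj opprK [LHS]sA AJ -AJl.
by move=> X Y; apply: J_eq0; rewrite -AJl.
Qed.

End Metric.

Theorem corollary3p3 (R : realType) (n : nat) (M : manifold R n)
    (J : {linear 'X(M) -> 'X(M)}) (g : 'X(M) -> 'X(M) -> C^oo(M))
    (nabla_g nabla_sk : 'X(M) -> 'X(M) -> 'X(M)) :
  almost_hermitian J g ->
  levi_civita g nabla_g ->
  ~ parallel_J nabla_g J ->
  type_G1 J g ->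
  skew_torsion_connection J g nabla_sk ->
  pi_J J (nabla_plus nabla_g nabla_sk) = nabla_plus nabla_g nabla_sk /\
  unique (chern_connection J g) (pi_J J (nabla_minus nabla_g nabla_sk)).
Proof.
move=> aJ [cg pg tg] _ _ [] [csk Jsk gsk] skT.
have [rg J2 gJ] := aJ.
pose A X Y : 'X(M) := nabla_sk X Y - nabla_g X Y.
have bA : bilinear_map A by exact: connection_sub.
have sA X Y Z : g (A X Y) Z = - g (A X Z) Y by exact: (parallel_g_sub rg).
have skE : nabla_sk = fun X Y => nabla_g X Y + A X Y.
  by apply/funext => X; apply/funext => Y; rewrite /A addrC subrK.
(* From here on [A] is known only through [bA], [sA] and [skE]. *)
clearbody A.
have TA : torsion nabla_sk = fun X Y => A X Y - A Y X.
  apply/funext => X; apply/funext => Y.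
  by rewrite {1}skE torsion_add tg add0r.
have altA : forall X Y, A Y X = - A X Y.
  by apply: (skew_of_totally_skew rg sA); rewrite -TA.
have T2A X Y : torsion nabla_sk X Y = A X Y + A X Y.
  by rewrite TA (altA X Y) opprK.
have JJsk X Y : nabla_sk X (J Y) = J (nabla_sk X Y).
  by apply/eqP; rewrite -subr_eq0; apply/eqP/Jsk.
have plusE : nabla_plus nabla_g nabla_sk = nabla_sk.
  apply/funext => X; apply/funext => Y.
  by rewrite /nabla_plus T2A smooth_halfK skE.
(* [B] is the formula of [pi_J] applied to [- 2 A]; the [nabla_sk] part is fixed. *)
pose B X Y : 'X(M) := J (A X (J Y)) - A X Y.
have minusE : pi_J J (nabla_minus nabla_g nabla_sk) =
    fun X Y => nabla_sk X Y + B X Y.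
  have mE X Y : nabla_minus nabla_g nabla_sk X Y =
      nabla_sk X Y - (A X Y + A X Y).
    by rewrite /nabla_minus T2A smooth_halfK skE addrKA.
  apply/funext => X; apply/funext => Y.
  rewrite /pi_J !mE JJsk -[RHS]smooth_halfK -scalerBr; congr (_ *: _).
  rewrite (linearB J) J2 (linearD J) [RHS]addrACA [B _ _ + _]addrACA.
  by rewrite -[- _ - _]opprD opprK [LHS]addrACA [- _ + _]addrC opprD.
split.
  rewrite plusE; apply/funext => X; apply/funext => Y.
  by rewrite /pi_J JJsk J2 scalerN opprK -scalerDr smooth_halfK.
have bB : bilinear_map B.
  split=> f X Y Z; rewrite /B.
    by rewrite !bA.1 (linearP J) scalerBr opprD addrACA.
  by rewrite (linearP J) !bA.2 (linearP J) scalerBr opprD addrACA.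
have JB X Y : B X (J Y) = J (B X Y).
  by rewrite /B J2 (bilinearNr _ _ bA) (linearN J) (linearB J) J2 addrC.
have sB X Y Z : g (B X Y) Z = - g (B X Z) Y.
  rewrite /B !(metricDl rg) !(metricNl rg) !(hermitian_adj rg aJ).
  by rewrite (sA X (J Y)) (sA X Y) -opprD.
have chB : chern_connection J g (fun X Y => nabla_sk X Y + B X Y).
  split; first by split; [exact: connection_add|exact: parallel_J_add|
    exact: (parallel_g_add rg)].
  (* Antisymmetrizing the term [- A X Y] of [B] gives [- 2 A X Y], which cancels the torsion of
     [nabla_sk]. *)
  have tB X Y : torsion (fun X Y => nabla_sk X Y + B X Y) X Y =
      J (A X (J Y) + A (J X) Y).
    rewrite torsion_add T2A /B (altA X Y) (altA (J X) Y) opprK.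
    rewrite (linearN J) [RHS](linearD J) opprD opprK [J _ - _ + _]addrACA.
    by rewrite -opprD [LHS]addrC subrK.
  (* Since [J] squares to minus the identity, the two summands are exchanged and negated. *)
  move=> X Y; rewrite !tB !J2 (bilinearNr _ _ bA) (bilinearNl _ _ bA).
  by rewrite -opprD addrC (linearN J).
(* Uniqueness: the difference of two Chern connections meets the hypotheses of
   [hermitian_difference_eq0]. *)
rewrite minusE; split=> // D [] [cD JD gD] tD.
case: (chB) => [] [cB JcB gB] tcB.
apply/funext => X; apply/funext => Y; apply/eqP; rewrite -subr_eq0; apply/eqP.
apply: (hermitian_difference_eq0 rg aJ
  (A := fun X Y => nabla_sk X Y + B X Y - D X Y)) => {X Y}.
- exact: (connection_sub cB cD).
- exact: (parallel_J_sub JcB JD).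
- exact: (parallel_g_sub rg gB gD).
- move=> X Y; pose P X' Y' : 'X(M) := nabla_sk X' Y' + B X' Y'.
  rewrite (torsion_sub P D) (torsion_sub P D X) tcB tD.
  by rewrite -opprD.
Qed.
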